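(* Let $n\ge 2$, let $\Bbbk$ be a field, and let $G$ be the anticycle on the $n+3$ vertices $x,z_1,y_1,y_2,\ldots,y_n,z_2$, i.e. the complement of the cycle which visits the vertices in the cyclic order $x, z_1, y_1, y_2, \ldots, y_n, z_2$ (and returns to $x$). Let $I(G)\subset \Bbbk[x,z_1,z_2,y_1,\ldots,y_n]$ be its edge ideal. Let $H=G\setminus\{x\}$ be the induced subgraph of $G$ on the vertices other than $x$, let $J=I(H)$ be the edge ideal of $H$, and let $K=(xy_i : i=1,\ldots,n)$ be the ideal generated by the edges of $G$ not in $H$. Then $I(G)^2$ has linear quotients, and a linear quotients ordering of its minimal monomial generators is given by the following list (generators occurring earlier in the list come earlier in the ordering; in each lex-ordered block the lex-larger monomials come first): (1) the minimal monomial generators $m$ of $J^2$, ordered via the lex ordering with $z_1<y_1<y_2<\cdots<y_n<z_2$; (2) the minimal monomial generators $m$ of $J\cdot K$, in the following order: (2a) $m=xy_iz_1z_2$ for $i=1,\ldots,n$ (in this order); (2b) $m=xy_iy_jz_2$ with $1\le i\le j\le n$, ordered via lex with $y_1>y_2>\cdots>y_n$, excluding the nongenerator $xy_n^2z_2$; (2c) $m=xy_iy_jz_1$ with $1\le i\le j\le n$, ordered via lex with $y_1<y_2<\cdots<y_n$, excluding the nongenerator $xy_1^2z_1$; (2d) those $m=xy_iy_jy_k$ with $1\le i\le j\le k\le n$ that belong to $J\cdot K$, ordered via lex with $y_1>y_2>\cdots>y_n$; (3) the minimal monomial generators $m$ of $K^2$, in the following order: (3a) $m=x^2y_iy_j$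 with $1\le i\le j\le n$, excluding $x^2y_1^2$, ordered via lex with $y_1>y_2>\cdots>y_n$; (3b) $m=x^2y_1^2$.
   Context: For a simple graph $G$, the edge ideal $I(G)$ is the squarefree monomial ideal, in the polynomial ring over a field $\Bbbk$ whose variables are the vertices of $G$, generated by the products $uv$ over all edges $\{u,v\}$ of $G$. The complement of a graph is the graph on the same vertices whose edges are exactly the non-edges of the original graph. A monomial ideal $I$ has linear quotients if its minimal monomial generators can be ordered $m_1,m_2,\ldots,m_r$ so that for every $i>1$ the colon ideal $(m_1,\ldots,m_{i-1}):(m_i)$ is generated by a subset of the variables; such an ordering is called a linear quotients ordering of $I$. With the labelling used, the non-adjacent pairs of distinct vertices in $G$ are exactly $\{x,z_1\}$, $\{z_1,y_1\}$, $\{y_i,y_{i+1}\}$ for $1\le i\le n-1$, $\{y_n,z_2\}$ and $\{z_2,x\}$; all other pairs of distinct vertices are edges of $G$. *)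

(* Defs.v *)
From HB Require Import structures.
From mathcomp Require Import all_boot all_order all_algebra.
From mathcomp Require Export mpoly.
Set Implicit Arguments.
Unset Strict Implicit.
Unset Printing Implicit Defensive.
Import Order.TTheory GRing.Theory.
Local Open Scope ring_scope.

(* Ideals are not detachable in general, so they are Prop-valued predicates. *)
Section Ideals.
Variable R : comNzRingType.
Implicit Types I J S : R -> Prop.

Definition ideal_eq I J : Prop := forall f, I f <-> J f.

Definition ideal_gen S : R -> Prop := fun f =>
  exists2 s : seq (R * R), (forall p, p \in s -> S p.2) &
    f = \sum_(p <- s) p.1 * p.2.

Definition ideal_mul I J : R -> Prop :=
  ideal_gen (fun f => exists a b, [/\ I a, J b & f = a * b]).

Definition ideal_colon I J : R -> Prop := fun f => forall g, J g -> I (f * g).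

End Ideals.

Section MonomialIdeals.
Variables (N : nat) (k : fieldType).
Implicit Types (I : {mpoly k[N]} -> Prop) (s : seq 'X_{1..N}).

Definition mon_ideal (S : 'X_{1..N} -> Prop) : {mpoly k[N]} -> Prop :=
  ideal_gen (fun f => exists2 m, S m & f = 'X_[m]).

Definition var_ideal (A : {set 'I_N}) : {mpoly k[N]} -> Prop :=
  ideal_gen (fun f => exists2 v, v \in A & f = 'X_v).

Definition is_monomial_ideal I : Prop := exists S, ideal_eq I (mon_ideal S).

(* [(m' <= m)%MM] is divisibility of monomials. *)
Definition min_gen I (m : 'X_{1..N}) : Prop :=
  I 'X_[m] /\ forall m', I 'X_[m'] -> (m' <= m)%MM -> m' = m.

Definition linear_quotients_ordering I s : Prop :=
  [/\ is_monomial_ideal I, uniq s, (forall m, m \in s <-> min_gen I m) &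
      forall i, (0 < i < size s)%N -> exists A : {set 'I_N},
        ideal_eq
          (ideal_colon (mon_ideal (fun m => m \in take i s))
                       (mon_ideal (fun m => m = nth 0%MM s i)))
          (var_ideal A)].

Definition has_linear_quotients I : Prop :=
  exists s, linear_quotients_ordering I s.

End MonomialIdeals.

(* Simple graphs whose vertices are among the variables 'X_0, ..., 'X_(N-1). *)
Record sgraph (N : nat) := SGraph {
  verts : {set 'I_N};
  adj : rel 'I_N;
  adj_sym : ssrbool.symmetric adj;
  adj_irr : irreflexive adj;
  adj_verts : forall u v, adj u v -> u \in verts
}.

Section Graphs.
Variable N : nat.
Implicit Type G : sgraph N.

Definition compl_adj G : rel 'I_N := fun u v =>
  [&& u \in verts G, v \in verts G, u != v & ~~ adj G u v].

Lemma compl_adj_sym G : ssrbool.symmetric (compl_adj G).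
Proof. by move=> u v; rewrite /compl_adj adj_sym eq_sym andbCA. Qed.

Lemma compl_adj_irr G : irreflexive (compl_adj G).
Proof. by move=> u; rewrite /compl_adj eqxx !andbF. Qed.

Lemma compl_adj_verts G u v : compl_adj G u v -> u \in verts G.
Proof. by case/andP. Qed.

Definition complement G : sgraph N :=
  SGraph (@compl_adj_sym G) (@compl_adj_irr G) (@compl_adj_verts G).

Definition del_adj G (w : 'I_N) : rel 'I_N := fun u v =>
  [&& u != w, v != w & adj G u v].

Lemma del_adj_sym G w : ssrbool.symmetric (del_adj G w).
Proof. by move=> u v; rewrite /del_adj adj_sym andbCA. Qed.

Lemma del_adj_irr G w : irreflexive (del_adj G w).
Proof. by move=> u; rewrite /del_adj adj_irr !andbF. Qed.

Lemma del_adj_verts G w u v : del_adj G w u v -> u \in verts G :\ w.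
Proof.
by case/and3P=> uw _ /adj_verts uG; rewrite in_setD1 uw uG.
Qed.

Definition del_vertex G w : sgraph N :=
  SGraph (@del_adj_sym G w) (@del_adj_irr G w) (@del_adj_verts G w).

(* The conjunct [u != v] only matters for N = 1. *)
Definition cycle_adj : rel 'I_N := fun u v =>
  (u != v) && ((v == ordS u) || (u == ordS v)).

Lemma cycle_adj_sym : ssrbool.symmetric cycle_adj.
Proof. by move=> u v; rewrite /cycle_adj eq_sym orbC. Qed.

Lemma cycle_adj_irr : irreflexive cycle_adj.
Proof. by move=> u; rewrite /cycle_adj eqxx. Qed.

Lemma cycle_adj_verts u v : cycle_adj u v -> u \in [set: 'I_N].
Proof. by rewrite inE. Qed.

Definition cycle_graph : sgraph N :=
  SGraph cycle_adj_sym cycle_adj_irr cycle_adj_verts.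

Definition anticycle : sgraph N := complement cycle_graph.

Definition edge_ideal (k : fieldType) G : {mpoly k[N]} -> Prop :=
  ideal_gen (fun f => exists u v, adj G u v /\ f = 'X_u * 'X_v).

End Graphs.
Arguments anticycle : clear implicits.
Arguments edge_ideal {N} k G _.

(* [lex_gt vs m m']: m is strictly lex-larger than m', where [vs] lists the
   variables from the largest to the smallest. *)
Definition lex_gt N (vs : seq 'I_N) : rel 'X_{1..N} := fun m m' =>
  (([seq m' v | v <- vs] : seqlexi nat) < [seq m v | v <- vs])%O.

Definition lex_listing N (vs : seq 'I_N) (P : 'X_{1..N} -> Prop) s : Prop :=
  sorted (lex_gt vs) s /\ forall m, m \in s <-> P m.

Section AnticycleSquare.
Variables (k : fieldType) (n : nat).

(* The indices 0, ..., n+2 follow the cyclic order x, z1, y_1, ..., y_n, z2;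
   [vy i] is y_i, to be used for 1 <= i <= n only. *)
Definition vx : 'I_n.+3 := ord0.
Definition vz1 : 'I_n.+3 := inord 1.
Definition vy (i : nat) : 'I_n.+3 := inord i.+1.
Definition vz2 : 'I_n.+3 := ord_max.

Definition vys : seq 'I_n.+3 := [seq vy i | i <- iota 1 n].

Local Notation X := U_(vx)%MM.
Local Notation Z1 := U_(vz1)%MM.
Local Notation Z2 := U_(vz2)%MM.
Local Notation Y i := U_(vy i)%MM.

Definition idealI : {mpoly k[n.+3]} -> Prop := edge_ideal k (anticycle n.+3).

(* The extension to k[x, z1, z2, y_1, ..., y_n] of the edge ideal of G \ {x}. *)
Definition idealJ : {mpoly k[n.+3]} -> Prop :=
  edge_ideal k (del_vertex (anticycle n.+3) vx).

Definition idealK : {mpoly k[n.+3]} -> Prop :=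
  ideal_gen (fun f => exists2 i, (1 <= i <= n)%N & f = 'X_vx * 'X_(vy i)).

Definition listing1 (s : seq 'X_{1..n.+3}) : Prop :=
  lex_listing (vz2 :: rcons (rev vys) vz1)
    (min_gen (ideal_mul idealJ idealJ)) s.

Definition list2a : seq 'X_{1..n.+3} :=
  [seq (X + Y i + Z1 + Z2)%MM | i <- iota 1 n].

Definition listing2b (s : seq 'X_{1..n.+3}) : Prop :=
  lex_listing vys (fun m =>
    (exists i j, [/\ (1 <= i)%N, (i <= j)%N, (j <= n)%N &
                     m = (X + Y i + Y j + Z2)%MM])
    /\ m <> (X + Y n + Y n + Z2)%MM) s.

Definition listing2c (s : seq 'X_{1..n.+3}) : Prop :=
  lex_listing (rev vys) (fun m =>
    (exists i j, [/\ (1 <= i)%N, (i <= j)%N, (j <= n)%N &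
                     m = (X + Y i + Y j + Z1)%MM])
    /\ m <> (X + Y 1 + Y 1 + Z1)%MM) s.

Definition listing2d (s : seq 'X_{1..n.+3}) : Prop :=
  lex_listing vys (fun m =>
    (exists i j l, [/\ (1 <= i)%N, (i <= j)%N, (j <= l)%N, (l <= n)%N &
                       m = (X + Y i + Y j + Y l)%MM])
    /\ ideal_mul idealJ idealK 'X_[m]) s.

Definition listing3a (s : seq 'X_{1..n.+3}) : Prop :=
  lex_listing vys (fun m =>
    (exists i j, [/\ (1 <= i)%N, (i <= j)%N, (j <= n)%N &
                     m = (X + X + Y i + Y j)%MM])
    /\ m <> (X + X + Y 1 + Y 1)%MM) s.

Definition list3b : seq 'X_{1..n.+3} := [:: (X + X + Y 1 + Y 1)%MM].

Definition listing2 (s : seq 'X_{1..n.+3}) : Prop :=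
  (forall m, m \in s <-> min_gen (ideal_mul idealJ idealK) m) /\
  exists s2b s2c s2d,
    [/\ listing2b s2b, listing2c s2c, listing2d s2d &
        s = list2a ++ s2b ++ s2c ++ s2d].

Definition listing3 (s : seq 'X_{1..n.+3}) : Prop :=
  (forall m, m \in s <-> min_gen (ideal_mul idealK idealK) m) /\
  exists2 s3a, listing3a s3a & s = s3a ++ list3b.

Definition square_listing (s : seq 'X_{1..n.+3}) : Prop :=
  exists s1 s2 s3,
    [/\ listing1 s1, listing2 s2, listing3 s3 & s = s1 ++ s2 ++ s3].

End AnticycleSquare.
Arguments idealI k n _ : clear implicits.
Arguments idealJ k n _ : clear implicits.
Arguments idealK k n _ : clear implicits.

(* Main.v *)
Require Import Defs.
From mathcomp Require Import all_boot all_order all_algebra zify.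

(** A product of four vertices is encoded by the sorted quadruple (a, b, c, d) of
    their positions on the cycle, with x at 0, z1 at 1, y_i at i+1 and z2 at n+2.  It
    is a product of two edges if and only if ac and bd are edges.

    As all generators have the same degree, the ordering is a linear quotients
    ordering as soon as, for every m and every earlier m', some variable v with larger
    exponent in m' than in m and some variable w dividing m are such that v m / w also
    comes earlier.  When m and m' lie in the same block, v is the first variable at
    which they differ and w is the factor of m at the same place.  When m = x t lies
    in J K and m' in J^2, take w = x, so that v m / w lies in J^2.  This fails for all
    possible v only if t or its top or bottom pair is confined to neighbouring
    vertices; then m' forces the presence of a neighbour by which a factor of t can be
    replaced, giving an earlier generator of J K.  The generators of K^2 are treated
    likewise. *)

Set Implicit Arguments.
Unset Strict Implicit.
Unset Printing Implicit Defensive.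
Import Order.TTheory GRing.Theory.

(** * Monomial ideals *)

Section IdealGen.
Variable R : comNzRingType.
Implicit Types (S T I J : R -> Prop) (f g r : R).

Lemma ideal_gen0 S : ideal_gen S 0%R.
Proof. by exists [::]; rewrite ?big_nil. Qed.

Lemma ideal_genD S f g : ideal_gen S f -> ideal_gen S g -> ideal_gen S (f + g)%R.
Proof.
move=> [s sS ->] [s' s'S ->]; exists (s ++ s'); last by rewrite big_cat.
by move=> p; rewrite mem_cat => /orP[/sS|/s'S].
Qed.

Lemma ideal_genM S r f : ideal_gen S f -> ideal_gen S (r * f)%R.
Proof.
move=> [s sS ->]; exists [seq (r * p.1, p.2)%R | p <- s].
  by move=> _ /mapP[p /sS pS ->].
by rewrite big_map big_distrr; apply: eq_bigr => p _; rewrite /= mulrA.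
Qed.

Lemma ideal_gen_in S f : S f -> ideal_gen S f.
Proof.
move=> Sf; exists [:: (1, f)%R]; last by rewrite big_seq1 mul1r.
by move=> p; rewrite inE => /eqP->.
Qed.

Lemma ideal_gen_ind S (P : R -> Prop) :
  P 0%R -> (forall f g, P f -> P g -> P (f + g)%R) ->
  (forall r f, S f -> P (r * f)%R) -> forall f, ideal_gen S f -> P f.
Proof.
move=> P0 PD PM f [s sS ->]; elim: s sS => [|p s IHs] sS; first by rewrite big_nil.
rewrite big_cons; apply: PD; first by apply/PM/sS; rewrite inE eqxx.
by apply: IHs => q qs; apply: sS; rewrite inE qs orbT.
Qed.

Lemma ideal_gen_sub S T :
  (forall f, S f -> ideal_gen T f) -> forall f, ideal_gen S f -> ideal_gen T f.
Proof.
move=> ST; apply: ideal_gen_ind => [|f g|r f /ST].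
- exact: ideal_gen0.
- exact: ideal_genD.
- exact: ideal_genM.
Qed.

Lemma ideal_gen_ext S T :
  (forall f, S f <-> T f) -> ideal_eq (ideal_gen S) (ideal_gen T).
Proof.
by move=> ST f; split; apply: ideal_gen_sub => g /ST; apply: ideal_gen_in.
Qed.

End IdealGen.

Section MonIdeal.
Variables (N : nat) (k : fieldType).
Implicit Types (S T : 'X_{1..N} -> Prop) (I J f : {mpoly k[N]}) (m u : 'X_{1..N}).

Lemma mon_ideal_ext S T :
  (forall m, S m <-> T m) -> ideal_eq (@mon_ideal N k S) (@mon_ideal N k T).
Proof.
by move=> ST; apply: ideal_gen_ext => f; split=> -[m Sm ->]; exists m => //; apply/ST.
Qed.

(** The condition on supports is stable under sums and multiples and holds for the generators;
    conversely, [f] is the sum of its terms, each a multiple of a generator. *)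
Lemma mon_idealP S f :
  mon_ideal S f <-> forall u, u \in msupp f -> exists2 m, S m & (m <= u)%MM.
Proof.
split.
  move: f; apply: ideal_gen_ind => [u|f g Pf Pg u|r _ [m Sm ->] u].
  - by rewrite msupp0.
  - by move/msuppD_le; rewrite mem_cat => /orP[/Pf|/Pg].
  - rewrite (perm_mem (msuppMX r m)) => /mapP[u' _ ->]; exists m => //.
    exact: lem_addr.
move=> Pf; rewrite (mpolyE f).
elim: (msupp f) Pf => [|u s IHs] Ps; first by rewrite big_nil; apply: ideal_gen0.
rewrite big_cons; apply: ideal_genD; last by apply: IHs => v vs; apply: Ps; rewrite inE vs orbT.
have [|m Sm mu] := Ps u; first by rewrite inE eqxx.
rewrite -(submK mu) mpolyXD scalerAl; apply: ideal_genM.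
by apply: ideal_gen_in; exists m.
Qed.

Lemma mon_idealX S m : @mon_ideal N k S 'X_[m] <-> exists2 m', S m' & (m' <= m)%MM.
Proof.
rewrite mon_idealP; split=> [|[m' ? ?] u]; last first.
  by rewrite msuppX inE => /eqP->; exists m'.
by apply; rewrite msuppX inE.
Qed.

Lemma ideal_mul_mon (I J : {mpoly k[N]} -> Prop) S T :
  ideal_eq I (mon_ideal S) -> ideal_eq J (mon_ideal T) ->
  ideal_eq (ideal_mul I J)
    (mon_ideal (fun m => exists s t, [/\ S s, T t & m = (s + t)%MM])).
Proof.
move=> IS JT f; split; apply: ideal_gen_sub => {}f.
  move=> [a [b [/IS Sa /JT Tb ->]]].
  move: a Sa; apply: ideal_gen_ind => [|f1 f2|r _ [s Ss ->]].
  - by rewrite mul0r; apply: ideal_gen0.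
  - by rewrite mulrDl; apply: ideal_genD.
  rewrite -mulrA; apply: ideal_genM.
  move: b Tb; apply: ideal_gen_ind => [|f1 f2|r' _ [t Tt ->]].
  - by rewrite mulr0; apply: ideal_gen0.
  - by rewrite mulrDr; apply: ideal_genD.
  rewrite mulrCA; apply: ideal_genM; apply: ideal_gen_in.
  by exists (s + t)%MM; [exists s, t|rewrite mpolyXD].
move=> [_ [s [t [Ss Tt ->]]] ->]; apply: ideal_gen_in.
exists 'X_[s], 'X_[t]; split; last exact: mpolyXD.
  by apply/IS/ideal_gen_in; exists s.
by apply/JT/ideal_gen_in; exists t.
Qed.

Lemma lem_mdeg_eq m u : (m <= u)%MM -> mdeg m = mdeg u -> m = u.
Proof.
move=> mu; rewrite -{1}(submK mu) mdegD => /esym/eqP.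
rewrite -{2}(add0n (mdeg m)) eqn_add2r mdeg_eq0 => /eqP um.
by rewrite -(submK mu) um add0m.
Qed.

(** Divisibility between two monomials of the same degree is equality, so no generator is redundant.
    A monomial of the ideal dividing a generator [m] is itself divisible by a generator, which must
    be [m]. *)
Lemma min_gen_homog (I : {mpoly k[N]} -> Prop) S e :
  ideal_eq I (mon_ideal S) -> (forall m, S m -> mdeg m = e) ->
  forall m, min_gen I m <-> S m.
Proof.
move=> IS Se m; split=> [[/IS/mon_idealX[m' Sm' m'm] min]|Sm].
  have <- // : m' = m.
  by apply: min => //; apply/IS/mon_idealX; exists m' => //; apply: lepm_refl.
split; first by apply/IS/mon_idealX; exists m => //; apply: lepm_refl.
move=> m' /IS/mon_idealX[u Su um'] m'm.
have um : u = m by apply: lem_mdeg_eq (lepm_trans um' m'm) _; rewrite !Se.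
apply/mnmP => i; apply/eqP; rewrite eqn_leq.
by rewrite (mnm_lepP m'm i) -{1}um (mnm_lepP um' i).
Qed.

Lemma var_idealP (A : {set 'I_N}) f :
  var_ideal A f <-> forall u, u \in msupp f -> exists2 v, v \in A & 0 < u v.
Proof.
have -> : var_ideal A f <-> mon_ideal (fun m => exists2 v, v \in A & m = U_(v)%MM) f.
  by apply: ideal_gen_ext => g; split=> [[v vA ->]|[_ [v vA ->] ->]];
     [exists U_(v)%MM => //|]; exists v.
rewrite mon_idealP; split=> P u /P.
  by move=> [_ [v vA ->]]; rewrite lep1mP -lt0n; exists v.
by move=> [v vA uv]; exists U_(v)%MM; [exists v|rewrite lep1mP -lt0n].
Qed.

Lemma mon_colonP S m f :
  ideal_colon (mon_ideal S) (mon_ideal (fun m' => m' = m)) f <->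
  forall u, u \in msupp f -> exists2 s, S s & (s <= u + m)%MM.
Proof.
split=> [Cf u uf|Pf].
  have /mon_idealP : mon_ideal S (f * 'X_[m])%R.
    by apply: Cf; apply: ideal_gen_in; exists m.
  by apply; rewrite (perm_mem (msuppMX f m)); apply/mapP; exists u; rewrite // addmC.
apply: ideal_gen_ind => [|g h|r _ [_ -> ->]].
- by rewrite mulr0; apply: ideal_gen0.
- by rewrite mulrDr; apply: ideal_genD.
rewrite mulrCA; apply: ideal_genM; apply/mon_idealP => u.
by rewrite (perm_mem (msuppMX f m)) => /mapP[u' /Pf ? ->]; rewrite addmC.
Qed.

(** This is the exchange criterion. If [m'] divides [u + m], the excess of [m'] over [m] at [v]
    forces [v] to divide [u], while [m''] shows that [v] already lies in the colon ideal. *)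
Lemma linear_colon (s : seq 'X_{1..N}) m :
  (forall m', m' \in s -> exists v m'', [/\ m v < m' v, m'' \in s & (m'' <= m + U_(v))%MM]) ->
  exists A : {set 'I_N}, ideal_eq
    (ideal_colon (@mon_ideal N k (fun u => u \in s)) (mon_ideal (fun u => u = m)))
    (var_ideal A).
Proof.
(* The only possible choice: all variables contained in the colon ideal. *)
move=> ex; exists [set v | has (fun m' => m' <= m + U_(v))%MM s] => f.
rewrite mon_colonP var_idealP; split=> P u /P.
  move=> [m' m's m'u]; have [v [m'' [mv m''s ?]]] := ex _ m's.
  exists v; first by rewrite inE; apply/hasP; exists m''.
  have /mnm_lepP/(_ v) := m'u; rewrite mnmDE => /(leq_trans mv).
  by rewrite -{1}(add0n (m v)) ltn_add2r.
move=> [v]; rewrite inE => /hasP[m' m's m'v]; rewrite lt0n -lep1mP => uv; exists m' => //.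
apply: lepm_trans m'v _; rewrite addmC.
by apply/mnm_lepP => i; rewrite !mnmDE leq_add2r; have /mnm_lepP := uv.
Qed.
End MonIdeal.

(** * Exchange of factors *)

Definition quad := (nat * nat * nat * nat)%type.

Definition cnt (t : quad) (p : nat) : nat :=
  let: (a, b, c, d) := t in (a == p) + (b == p) + (c == p) + (d == p).

Ltac cnt_lia := rewrite /cnt; repeat (case: eqP => ?; try (exfalso; lia)); by lia.

Section Quads.
Variable n : nat.

(** Edges are written with the smaller position first. Positions at distance at least two are
    adjacent in the anticycle, except 0 and n+2 (x and z2), where the cycle closes up. *)
Definition edge (p q : nat) : bool :=
  [&& p + 2 <= q, q <= n.+2 & (p == 0) ==> (q <= n.+1)].

(* If a product of four vertices can be matched into two edges at all, then pairing
   its sorted factors crosswise works. *)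
Definition gen (t : quad) : bool :=
  let: (a, b, c, d) := t in [&& a <= b, b <= c, c <= d, edge a c & edge b d].

Lemma genP a b c d :
  reflect ([/\ a <= b, b <= c, c <= d & d <= n.+2] /\
           [/\ a + 2 <= c, b + 2 <= d, a = 0 -> c <= n.+1 & b = 0 -> d <= n.+1])
          (gen (a, b, c, d)).
Proof.
rewrite /gen /edge.
apply: (iffP and5P) => [[-> -> -> /and3P[-> _ ac] /and3P[-> -> bd]]|[[-> -> cd dn] [-> -> ac bd]]].
  by split; split=> // /eqP; apply/implyP.
by rewrite cd dn (leq_trans cd dn); split=> //; apply/implyP => /eqP.
Qed.

(* The blocks (1), (2a), ..., (2d), (3a), (3b) are numbered 0, ..., 6. *)
Definition kind (t : quad) : nat :=
  let: (a, b, c, d) := t in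
  if 0 < a then 0
  else if 0 < b then
    if b == 1 then if d == n.+2 then 1 else 3
    else if d == n.+2 then 2 else 4
  else if d == 2 then 6 else 5.

(* Comparing sorted factors from the smallest position on is lex with
   y_1 > ... > y_n; comparing them from the largest position on is lex with the
   order of the variables reversed, as used in (1) and (2c). *)
Definition key (t : quad) : seqlexi nat :=
  let: (a, b, c, d) := t in
  kind t :: (if kind t \in [:: 0; 3]
             then [:: n.+2 - d; n.+2 - c; n.+2 - b; n.+2 - a] else [:: a; b; c; d]).

Definition before (t t' : quad) : bool := (key t < key t')%O.

Lemma ltxi_cons_nat (x y : nat) (s s' : seqlexi nat) :
  ((x :: s : seqlexi nat) < y :: s')%O = (x < y) || (x == y) && (s < s')%O.
Proof. by rewrite ltxi_cons !leEnat; case: ltngtP. Qed.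

Lemma beforeE t t' : before t t' =
  (kind t < kind t') || (kind t == kind t') &&
  (let: (a, b, c, d) := t in let: (a', b', c', d') := t' in
   if kind t \in [:: 0; 3]
   then (n.+2 - d < n.+2 - d') || (n.+2 - d == n.+2 - d') &&
       ((n.+2 - c < n.+2 - c') || (n.+2 - c == n.+2 - c') &&
       ((n.+2 - b < n.+2 - b') || (n.+2 - b == n.+2 - b') &&
        (n.+2 - a < n.+2 - a')))
   else (a < a') || (a == a') && ((b < b') || (b == b') &&
       ((c < c') || (c == c') && (d < d')))).
Proof.
case: t => [[[a b] c] d]; case: t' => [[[a' b'] c'] d'].
rewrite /before /key; set k := kind _; set k' := kind _.
rewrite ltxi_cons_nat; case: (k =P k') => //= <-.
by case: ifP => _; rewrite !ltxi_cons_nat ltxx !andbF !orbF.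
Qed.

(** The last clause says that t'' divides v t; as degrees agree, t'' is v t / w for some factor w.
    This is the hypothesis of [linear_colon] in terms of positions. *)
Definition exchangeable t t' := exists t'' v,
  [/\ gen t'', before t'' t, v <= n.+2, cnt t v < cnt t' v &
      forall p, cnt t'' p <= cnt t p + (v == p)].

(** This and the next two lemmas specialize [genP] to J^2, J K and K^2, according to the exponent of
    x; they resolve the conditions at the closing pair {x, z2}. *)
Lemma gen0P a b c d : 0 < a ->
  reflect ([/\ a <= b, b <= c & c <= d] /\ [/\ d <= n.+2, a + 2 <= c & b + 2 <= d])
    (gen (a, b, c, d)).
Proof.
move=> a0; apply: (iffP (genP _ _ _ _)) => [[[? ? ? ?] [? ? _ _]]|[[? ? ?] [? ? ?]]] //.
by split; split=> //; lia.
Qed.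

Lemma gen1P b c d : 0 < b ->
  reflect ([/\ b <= c & c <= d] /\ [/\ d <= n.+2, 2 <= c, b + 2 <= d & c <= n.+1])
    (gen (0, b, c, d)).
Proof.
move=> b0; apply: (iffP (genP _ _ _ _)) => [[[? ? ? ?] [? ? cn _]]|[[? ?] [? ? ? ?]]].
  by split; split=> //; apply: cn.
by split; split=> //; lia.
Qed.

Lemma gen2P c d : reflect [/\ 2 <= c, c <= d & d <= n.+1] (gen (0, 0, c, d)).
Proof.
apply: (iffP (genP _ _ _ _)) => [[[? ? ? ?] [? ? _ dn]]|[? ? ?]]; first by split=> //; apply: dn.
by split; split=> //; lia.
Qed.

Ltac gen_lia := first
  [ apply/gen2P; split; lia
  | apply/gen1P; [move=> *; lia | split; split; lia]
  | apply/gen0P; [move=> *; lia | split; split; lia]].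

Ltac before_lia := rewrite beforeE /kind /=;
  repeat (case: ifP => ?; try (exfalso; lia)); rewrite ?inE /= //;
  repeat first [by lia | apply/orP; left; by lia
               | apply/orP; right; apply/andP; split; [by lia|]].

Ltac cnt_le_lia := let p := fresh in move=> p; rewrite /cnt;
  repeat match goal with |- context [nat_of_bool (?x == p)] =>
    move: (nat_of_bool (x == p)) => ? end; by lia.

Ltac exchange_with t v := exists t, v; split; [gen_lia | before_lia | lia | cnt_lia | cnt_le_lia].

(** * The exchange property, by pairs of blocks *)

Lemma before_inv a b c d a' b' c' d' :
  gen (a, b, c, d) -> gen (a', b', c', d') ->
  before (a', b', c', d') (a, b, c, d) ->
  kind (a', b', c', d') < kind (a, b, c, d) \/
  kind (a', b', c', d') = kind (a, b, c, d) /\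
  if kind (a, b, c, d) \in [:: 0; 3]
  then [\/ d < d', d = d' /\ c < c', [/\ d = d', c = c' & b < b']
       | [/\ d = d', c = c', b = b' & a < a']]
  else [\/ a' < a, a' = a /\ b' < b, [/\ a' = a, b' = b & c' < c]
       | [/\ a' = a, b' = b, c' = c & d' < d]].
Proof.
move=> /genP[[? ? ? ?] _] /genP[[? ? ? ?] _]; rewrite beforeE.
case/orP=> [|/andP[/eqP->]]; first by left.
move=> B; right; split=> //; case: ifP B => _.
  (* Truncated subtraction can be cancelled because positions are at most n+2. *)
  have nd x y : n.+2 - y = n.+2 - x -> y <= n.+2 -> x <= n.+2 -> x = y by lia.
  case/orP=> [?|/andP[/eqP/nd E]]; first by constructor 1; lia.
  have ? : d = d' by apply: E. clear E; subst d'.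
  case/orP=> [?|/andP[/eqP/nd E]]; first by constructor 2; lia.
  have ? : c = c' by apply: E; lia. clear E; subst c'.
  case/orP=> [?|/andP[/eqP/nd E ?]]; first by constructor 3; split; lia.
  have ? : b = b' by apply: E; lia. clear E; subst b'.
  by constructor 4; split; lia.
case/orP=> [?|/andP[/eqP->]]; first by constructor 1.
case/orP=> [?|/andP[/eqP->]]; first by constructor 2.
case/orP=> [?|/andP[/eqP->]]; first by constructor 3.
by constructor 4.
Qed.

(** Block (1) comes first, so [t'] lies in J^2 too. Raising the factor of t at the first difference
    from the top gives a generator: if the raised factor is c or d, its distance to its partner only
    grows; if it is a or b, the partner is shared with [t'], where the distance is large enough. *)
Lemma exchange_J2 a b c d t' : 0 < a -> gen (a,b,c,d) -> gen t' ->
  before t' (a,b,c,d) -> exchangeable (a,b,c,d) t'.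
Proof.
case: t' => [[[a' b'] c'] d'] a0 gt gt' B.
have a'0 : 0 < a' by move: B; rewrite beforeE /kind a0; case: (0 < a') => //=; do !case: ifP => ?.
have := before_inv gt gt' B; rewrite /kind a0 a'0 /=; clear B.
move: gt => /(gen0P _ _ _ a0) [[? ? ?] [? ? ?]].
move: gt' => /(gen0P _ _ _ a'0) [[? ? ?] [? ? ?]].
case=> // -[_ []]; [move=> ?|case=> ? ?; subst|case=> ? ? ?; subst|case=> ? ? ? ?; subst].
- by exchange_with (a,b,c,d') d'.
- by exchange_with (a,b,c',d') c'.
- by exchange_with (a,b',c',d') b'.
- by exchange_with (a',b',c',d') a'.
Qed.

Lemma exchange_JK_J2 b c d a' b' c' d' : 2 <= n -> 0 < b -> 0 < a' -> gen (0,b,c,d) ->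
  gen (a',b',c',d') -> exchangeable (0,b,c,d) (a',b',c',d').
Proof.
move=> n2 b0 a0 /(gen1P _ _ b0) [[? ?] [? ? ? ?]].
move=> /(gen0P _ _ _ a0) [[? ? ?] [? ? ?]].
have [cb|cb] := leqP c b.+1; have [dc|dc] := leqP d c.+1.
(* The factors b, c, d are consecutive. Any factor of t' outside their range can replace x;
   otherwise t' is the product of the squares of the two extremes. *)
- have ? : c = b.+1 by lia.
  have ? : d = b.+2 by lia. subst.
  have [?|?] := ltnP a' b; first by exchange_with (a',b,b.+1,b.+2) a'.
  have [?|?] := ltnP b.+2 d'; first by exchange_with (b,b.+1,b.+2,d') d'.
  have ? : a' = b by lia. have ? : b' = b by lia.
  have ? : c' = b.+2 by lia. have ? : d' = b.+2 by lia. subst.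
  (* The middle factor moves to the extreme that comes earlier in the order: downwards in general,
     but upwards for b = 1, since then the product lies in (2c), as 3 < n+2. *)
  have [?|?] := leqP b 1; last by exchange_with (0,b,b,b.+2) b.
  have ? : b = 1 by lia. subst; by exchange_with (0,1,3,3) 3.
(* Only the bottom pair b, c is tight: x is replaced by a factor far enough below c or above b. If
   there is none, then b = c and a' = c-1, and lowering b to c-1 gives an earlier generator of J
   K. *)
- have [?|?] := ltnP a' c.-1; first by exchange_with (a',b,c,d) a'.
  have [?|?] := leqP b.+2 c'.
    case: (ltngtP c' d) => ?; [by exchange_with (b,c,c',d) c'|by exchange_with (b,c,d,c') c'|].
    by subst; exchange_with (b,c,d,d') d'.
  have ? : b = c by lia. have ? : a' = c.-1 by lia. subst.
  by exchange_with (0,c.-1,c,d) c.-1.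
(* The mirror case, with only the top pair c, d tight. In the exceptional case c = d, b' = c-1 and
   d' = c+1; the order again dictates a move up exactly when b = 1. *)
- have [?|?] := leqP c.+2 d'; first by exchange_with (b,c,d,d') d'.
  have [?|?] := leqP b'.+2 d.
    case: (ltngtP b' b) => ?; [by exchange_with (b',b,c,d) b'|by exchange_with (b,b',c,d) b'|].
    by subst; exchange_with (a',b,c,d) a'.
  have ? : d = c by lia. have ? : d' = c.+1 by lia. have ? : b' = c.-1 by lia. subst.
  have [?|?] := leqP b 1; last by exchange_with (0,b,c.-1,c) c.-1.
  have ? : b = 1 by lia. subst; by exchange_with (0,1,c,c.+1) c.+1.
(* With both gaps at least two, x can always be replaced; the cases only find a factor whose
   exponent in t' exceeds that in t. *)
- have [?|?] := ltnP a' b; first by exchange_with (a',b,c,d) a'.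
  have [?|?] := ltnP d d'; first by exchange_with (b,c,d,d') d'.
  case: (ltngtP b b') => ?; [|lia|]; last first.
    have ? : a' = b by lia. subst; by exchange_with (b',b',c,d) b'.
  case: (ltngtP c' d) => ?; [|lia|]; last first.
    have ? : d' = d by lia. subst; by exchange_with (b,c,d,d) d.
  case: (ltngtP b' c) => ?; [by exchange_with (b,b',c,d) b'|by exchange_with (b,c,b',d) b'|subst].
  case: (ltngtP c' c) => ?; [lia|by exchange_with (b,c,c',d) c'|subst].
  by exchange_with (b,c,c,d) c.
Qed.

(** The cases record whether z1 (b = 1) and z2 (d = n+2) divide t. If t' lies in an earlier block,
    it contains one of them that t lacks; putting it in place of b or d leads to an earlier block.
    Within a block, the first difference works. *)
Lemma exchange_JK_JK b c d b' c' d' : 2 <= n -> 0 < b -> 0 < b' -> gen (0,b,c,d) ->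
  gen (0,b',c',d') -> before (0,b',c',d') (0,b,c,d) -> exchangeable (0,b,c,d) (0,b',c',d').
Proof.
move=> n2 b0 b'0 gt gt' B.
have := before_inv gt gt' B; rewrite /kind b0 b'0 /=; clear B.
move: gt => /(gen1P _ _ b0) [[? ?] [? ? ? ?]].
move: gt' => /(gen1P _ _ b'0) [[? ?] [? ? ? ?]].
case: (b =P 1) => ?; case: (d =P n.+2) => ?; subst; rewrite ?inE ?eqxx /=.
- case=> [|[E]]; first by do !case: ifP.
  have ? : b' = 1 by move: E; do !case: ifP => /eqP; lia.
  have ? : d' = n.+2 by move: E; do !case: ifP => /eqP; lia.
  subst; case; [lia|lia|case=> _ _ ?|case; lia].
  by exchange_with (0,1,c',n.+2) c'.
- case=> [|[E]].
    case: (d' =P n.+2) => [?|]; last by do !case: ifP.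
    by subst=> _; exchange_with (0,1,c,n.+2) n.+2.
  have ? : b' = 1 by move: E; do !case: ifP; lia.
  case; [move=> ?|case=> ? ?; subst|case; lia|case; lia].
    by exchange_with (0,1,c,d') d'.
  by exchange_with (0,1,c',d') c'.
- case=> [|[E]].
    case: (b' =P 1) => [?|]; last by do !case: ifP.
    by subst=> _; exchange_with (0,1,c,n.+2) 1.
  have ? : d' = n.+2 by move: E; do !case: ifP => /eqP; lia.
  subst; case; [lia|case=> _ ?|case=> _ ? ?; subst|case; lia].
    by exchange_with (0,b',c,n.+2) b'.
  by exchange_with (0,b,c',n.+2) c'.
- case=> [|[E]].
    case: (d' =P n.+2) => [?|]; first by subst=> _; exchange_with (0,b,c,n.+2) n.+2.
    case: (b' =P 1) => [?|//]; subst=> ? _; by exchange_with (0,1,c,d) 1.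
  have ? : d' <> n.+2 by move: E; do !case: ifP => /eqP.
  have ? : b' <> 1 by move: E; do !case: ifP => /eqP.
  case; [lia|case=> _ ?|case=> _ ? ?; subst|case=> _ ? ? ?; subst].
  + by exchange_with (0,b',c,d) b'.
  + by exchange_with (0,b,c',d) c'.
  + by exchange_with (0,b,c,d') d'.
Qed.

(** If v is some y_i, it replaces c and the product stays in (3a). If v is z1, it replaces x and the
    product falls into J K; the required distance from z1 to d is what 2 < d provides. *)
Lemma exchange_K2_low c d v t' : gen (0,0,c,d) -> 0 < v < c -> 2 < d -> 0 < cnt t' v ->
  exchangeable (0,0,c,d) t'.
Proof.
case: t' => [[[a' b'] c'] d'] /gen2P [? ? ?] /andP[? ?] ? v0.
have cv : cnt (0,0,c,d) v < cnt (a',b',c',d') v.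
  suff -> : cnt (0,0,c,d) v = 0 by [].
  by cnt_lia.
have [?|?] := leqP 2 v.
  by exists (0,0,v,d), v; split; [gen_lia|before_lia|lia|exact: cv|cnt_le_lia].
by exists (0,v,c,d), v; split; [gen_lia|before_lia|lia|exact: cv|cnt_le_lia].
Qed.

Lemma exchange_K2 c d a' b' c' d' : 2 <= n -> gen (0,0,c,d) ->
  gen (a',b',c',d') -> before (a',b',c',d') (0,0,c,d) -> exchangeable (0,0,c,d) (a',b',c',d').
Proof.
move=> n2 gt gt' B.
have B' := before_inv gt gt' B. clear B; have G := gt; have G' := gt'.
move: gt => /gen2P [? ? ?].
have [|d2] := leqP d 2.
  move=> ?; have ? : c = 2 by lia. have ? : d = 2 by lia. subst.
  move: gt' => /genP[[? ? ? ?] [? ? _ _]].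
  (* Here t = x^2 y_1^2 comes last. A factor d' = y_i of t' with i > 1 leads to (3a), and d' = z2
     replaces one x and leads to (2b). *)
  have ? : 3 <= d'.
    have [|?] := posnP b'; last lia.
    move=> b0; have ? : a' = 0 by lia.
    subst; move: B'; rewrite /kind /=.
    case: eqP => [?|? _]; last lia.
    by case=> // -[_]; case; try lia; case; lia.
  have [?|?] := leqP d' n.+1; first by exchange_with (0,0,2,d') d'.
  by exchange_with (0,2,2,d') d'.
have [|a0] := posnP a'; last first.
  have [?|?] := ltnP a' c.
    by apply: (exchange_K2_low (v:=a')) => //; [rewrite a0|rewrite /cnt eqxx; lia].
  (* Now all factors of t' are at least c, hence d' >= c+2 and d' can replace one x. If d' = d, its
     exponent need not exceed that in t, and c' is used instead. *)
  move: gt' => /(gen0P _ _ _ a0) [[? ? ?] [? ? ?]].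
  case: (ltngtP d' d) => ?; [by exchange_with (0,c,d',d) d'|by exchange_with (0,c,d,d') d'|subst].
  by exchange_with (0,c,c',d) c'.
move=> ?; subst.
have [|b0] := posnP b'; last first.
  have [?|?] := ltnP b' c.
    by apply: (exchange_K2_low (v:=b')) => //; [rewrite b0|rewrite /cnt eqxx; lia].
  move: gt' => /(gen1P _ _ b0) [[? ?] [? ? ?]].
  case: (ltngtP d' d) => ?; [by exchange_with (0,c,d',d) d'|by exchange_with (0,c,d,d') d'|subst].
  by exchange_with (0,c,c',d) c'.
move=> ?; subst.
move: gt' => /gen2P [? ? ?]; move: B'; rewrite /kind /= (gtn_eqF d2).
case: (d' =P 2) => ?; first by case=> // [] [].
case=> // -[_] /=; case; [lia|lia|case=> _ _ ?|case=> _ _ ? ?; subst].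
  by exchange_with (0,0,c',d) c'.
by exchange_with (0,0,c,d') d'.
Qed.

Lemma exchange t t' : 2 <= n -> gen t -> gen t' -> before t' t -> exchangeable t t'.
Proof.
case: t => [[[a b] c] d]; case: t' => [[[a' b'] c'] d'] n2 gt gt' B.
have [a0|a0] := posnP a; last exact: exchange_J2.
subst; have [b0|b0] := posnP b; first by subst; apply: exchange_K2.
have [a'0|a'0] := posnP a'; last exact: exchange_JK_J2.
subst; have [b'0|b'0] := posnP b'; last exact: exchange_JK_JK.
by move: B; rewrite b'0 beforeE /kind b0 /=; do !case: ifP.
Qed.

End Quads.

(** * Generators as quadruples *)

Section Mon.
Variable n : nat.
Implicit Types t : quad.

(** The bounds encode the exclusions: [b <= n] in [Kind2] removes x y_n^2 z2, and [3 <= d] removes x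
    y_1^2 z1 in [Kind3] and x^2 y_1^2 in [Kind5]. *)
Variant kind_spec : quad -> nat -> Prop :=
| Kind0 a b c d of 0 < a & a <= b & b <= c & c <= d & d <= n.+2 & a + 2 <= c & b + 2 <= d :
    kind_spec (a, b, c, d) 0
| Kind1 c of 2 <= c <= n.+1 : kind_spec (0, 1, c, n.+2) 1
| Kind2 b c of 2 <= b & b <= c & c <= n.+1 & b <= n : kind_spec (0, b, c, n.+2) 2
| Kind3 c d of 2 <= c & c <= d & 3 <= d & d <= n.+1 : kind_spec (0, 1, c, d) 3
| Kind4 b c d of 2 <= b & b <= c & c <= d & b + 2 <= d & d <= n.+1 :
    kind_spec (0, b, c, d) 4
| Kind5 c d of 2 <= c & c <= d & 3 <= d & d <= n.+1 : kind_spec (0, 0, c, d) 5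
| Kind6 : kind_spec (0, 0, 2, 2) 6.

Lemma kindP t : gen n t -> kind_spec t (kind n t).
Proof.
case: t => [[[a b] c] d]; rewrite /kind; case: (posnP a) => [->|a0].
  case: (posnP b) => [->|b0].
    by move=> /gen2P[? ? ?]; case: eqP => ?; [have -> : c = 2 by lia|];
       subst; constructor; lia.
  move=> /(gen1P _ _ _ b0)[[? ?] [? ? ? ?]].
  by case: eqP => ?; case: eqP => ?; subst; constructor; lia.
by move=> /(gen0P _ _ _ _ a0)[[? ? ?] [? ? ?]]; constructor.
Qed.

Definition mon t : 'X_{1..n.+3} :=
  let: (a, b, c, d) := t in
  (U_(inord a) + U_(inord b) + U_(inord c) + U_(inord d))%MM.

Lemma inord_eq a p : a <= n.+2 -> p <= n.+2 ->
  ((inord a : 'I_n.+3) == inord p) = (a == p).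
Proof. by move=> an pn; rewrite -val_eqE /= !inordK. Qed.

Lemma monE t p : gen n t -> p <= n.+2 -> mon t (inord p) = cnt t p.
Proof.
case: t => [[[a b] c] d] /genP[[? ? ? ?] _] pn.
by rewrite /mon /cnt !mnmDE !mnm1E !inord_eq //; lia.
Qed.

Lemma mdeg_mon t : mdeg (mon t) = 4.
Proof. by case: t => [[[a b] c] d]; rewrite /mon !mdegD !mdeg1. Qed.

Lemma mon_inj : {in gen n &, injective mon}.
Proof.
move=> t t' gt gt' E.
have C p : p <= n.+2 -> cnt t p = cnt t' p by move=> pn; rewrite -!monE // E.
clear E.
case: t gt C => [[[a b] c] d] /genP[[ab bc cd dn] _].
case: t' gt' => [[[a' b'] c'] d'] /genP[[ab' bc' cd' dn'] _] C.
suff /= [-> -> -> -> //] : [:: a; b; c; d] = [:: a'; b'; c'; d'].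
apply: (sorted_eq leq_trans anti_leq); rewrite /= ?ab ?bc ?cd ?ab' ?bc' ?cd' //.
(* Sorted lists agree once they are permutations of each other, and [perm_eq] unfolds to equality of
   multiplicities at the entries of both. *)
apply/allP => p ps /=; rewrite -!(eq_sym p) !(eq_sym p); apply/eqP.
have := C p; rewrite /cnt !addn0 !addnA; apply.
by move: ps; rewrite !inE; lia.
Qed.

Lemma lex_gt_sorted (r : rel nat) (l : seq nat) (m m' : 'X_{1..n.+3}) p :
  transitive r -> sorted r l -> p \in l ->
  {in l, forall q, r q p -> m (inord q) = m' (inord q)} ->
  m' (inord p) < m (inord p) -> lex_gt [seq inord q | q <- l] m m'.
Proof.
rewrite /lex_gt => rT; elim: l => //= q l IHl ql; rewrite inE ltxi_cons_nat.
case: (p =P q) => [<- _ _ ->//|_ /= pl] E lt.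
have -> : m (inord q) = m' (inord q).
  by apply: E; [rewrite inE eqxx|move: ql; rewrite (path_sortedE rT) => /andP[/allP/(_ _ pl)]].
rewrite ltnn eqxx /=; apply: IHl => //; first exact: path_sorted ql.
by move=> q' ?; apply: E; rewrite inE orbC; apply/orP; left.
Qed.

Lemma before_asym t t' : before n t t' -> ~~ before n t' t.
Proof. by rewrite /before => /lt_gtF->. Qed.

Lemma key_inj : {in gen n &, injective (key n)}.
Proof.
move=> [[[a b] c] d] [[[a' b'] c'] d'] /genP[[? ? ? ?] _] /genP[[? ? ? ?] _].
rewrite /key => -[->]; case: ifP => _ -[*]; last by subst.
by congr (_, _, _, _); lia.
Qed.

Lemma before_total t t' : gen n t -> gen n t' ->
  [\/ t = t', before n t t' | before n t' t].
Proof.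
move=> gt gt'; rewrite /before.
case: (ltgtP (key n t) (key n t')) => [||/(key_inj gt gt')];
  by [constructor 1|constructor 2|constructor 3].
Qed.

(** Positions are bounded, so a block is a finite set, which is sorted by its injective key. *)
Lemma blocks_exist e : exists ts,
  pairwise (before n) ts /\ forall t, (t \in ts) = gen n t && (kind n t == e).
Proof.
pose q (u : 'I_n.+3 * 'I_n.+3 * 'I_n.+3 * 'I_n.+3) : quad :=
  (val u.1.1.1, val u.1.1.2, val u.1.2, val u.2).
pose ts := [seq t <- undup [seq q u | u <- enum {: _}] | gen n t && (kind n t == e)].
have tsE t : (t \in ts) = gen n t && (kind n t == e).
  rewrite mem_filter mem_undup; case: (boolP (gen n t)) => //= gt; case: eqP => //= _.
  case: t gt => [[[a b] c] d] /genP[[? ? ? ?] _].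
  have A : a < n.+3 by lia. have B : b < n.+3 by lia.
  have C : c < n.+3 by lia. have D : d < n.+3 by lia.
  by apply/mapP; exists (Ordinal A, Ordinal B, Ordinal C, Ordinal D); rewrite ?mem_enum.
pose le t t' := (key n t <= key n t')%O.
exists (sort le ts); split=> [|t]; last by rewrite mem_sort.
have U : uniq (map (key n) (sort le ts)).
  rewrite map_inj_in_uniq ?sort_uniq ?filter_uniq ?undup_uniq // => t t'.
  by rewrite !mem_sort !tsE => /andP[gt _] /andP[gt' _]; apply: key_inj.
have : sorted <%O (map (key n) (sort le ts)).
  rewrite lt_sorted_uniq_le U sorted_map sort_sorted // => t t'; exact: le_total.
by rewrite sorted_map; rewrite sorted_pairwise // => t t' t''; apply: lt_trans.
Qed.
End Mon.

(** * Edge ideals and their products in terms of quadruples *)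

Section Edges.
Variables (k : fieldType) (n : nat).
Implicit Types t : quad.

Lemma adj_edge (u v : 'I_n.+3) :
  adj (anticycle n.+3) u v = edge n u v || edge n v u.
Proof.
have mS (w : 'I_n.+3) : w.+1 %% n.+3 = if w == n.+2 :> nat then 0 else w.+1.
  case: eqP => [->|?]; first by rewrite modnn.
  by rewrite modn_small // -[_ < _]/(w < n.+2) ltn_neqAle -ltnS ltn_ord andbT; apply/eqP.
rewrite /= /compl_adj !inE /= /cycle_adj -!val_eqE /= !mS /edge.
have := ltn_ord u; have := ltn_ord v; rewrite !ltnS.
move: (val u) (val v) => {u v mS} p q pn qn.
case: (p =P n.+2) => ?; case: (q =P n.+2) => ?; case: (p =P 0) => ?; case: (q =P 0) => ?;
  case: (ltngtP p q) => ?; subst => //=; lia.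
Qed.

(** [B] tests whether the edge contains x, which can only be its smaller end; [predT], [negb] and
    [id] give the generators of I, J and K. *)
Definition edge_mon (B : pred bool) (m : 'X_{1..n.+3}) : Prop :=
  exists p q, [/\ edge n p q, B (p == 0) & m = (U_(inord p) + U_(inord q))%MM].

Lemma edge_lt p q : edge n p q -> [/\ p <= n.+2, q <= n.+2 & 0 < q].
Proof. by case/and3P; split; lia. Qed.

Lemma inord_0 : inord 0 = ord0 :> 'I_n.+3.
Proof. by apply: val_inj; rewrite /= inordK. Qed.

Lemma inord_max : inord n.+2 = ord_max :> 'I_n.+3.
Proof. by apply: val_inj; rewrite /= inordK. Qed.

Lemma idealI_mon : ideal_eq (idealI k n) (mon_ideal (edge_mon predT)).
Proof.
move=> f; apply: ideal_gen_ext => g; split=> [[u [v [uv ->]]]|[_ [p [q [pq _ ->]]] ->]].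
  move: uv; rewrite adj_edge => /orP[]uv; exists (U_(u) + U_(v))%MM; rewrite ?mpolyXD //.
    by exists u, v; rewrite !inord_val.
  by exists v, u; rewrite !inord_val addmC.
have [pn qn _] := edge_lt pq; exists (inord p), (inord q).
by rewrite mpolyXD adj_edge !inordK // pq.
Qed.

Lemma idealJ_mon : ideal_eq (idealJ k n) (mon_ideal (edge_mon negb)).
Proof.
move=> f; apply: ideal_gen_ext => g; split=> [[u [v [uv ->]]]|[_ [p [q [pq p0 ->]]] ->]].
  move: uv; rewrite [adj _ _ _]/(del_adj _ _ _ _) /del_adj adj_edge.
  case/and3P=> u0 v0 /orP[]uv; exists (U_(u) + U_(v))%MM; rewrite ?mpolyXD //.
    by exists u, v; rewrite !inord_val.
  by exists v, u; rewrite !inord_val addmC.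
have [pn qn q0] := edge_lt pq; exists (inord p), (inord q).
rewrite mpolyXD [adj _ _ _]/(del_adj _ _ _ _) /del_adj adj_edge !inordK // pq.
by rewrite /vx -inord_0 !inord_eq // p0 (gtn_eqF q0).
Qed.

Lemma idealK_mon : ideal_eq (idealK k n) (mon_ideal (edge_mon id)).
Proof.
move=> f; apply: ideal_gen_ext => g; split=> [[i /andP[i1 iN] ->]|[_ [p [q [pq /eqP p0 ->]]] ->]].
  exists (U_(inord 0) + U_(inord i.+1))%MM; last by rewrite mpolyXD inord_0.
  by exists 0, i.+1; split=> //; rewrite /edge; lia.
subst p; move: pq => /and3P[? ? /= ?]; exists q.-1; first by lia.
by rewrite mpolyXD inord_0 /vy prednK; last lia.
Qed.

(** The two edges are separated, interleaved or nested as intervals, and in each case the crosswise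
    pairing of the sorted ends consists of edges. The condition on b keeps track of whether the
    second edge contains x. *)
Lemma edge_mul p q p' q' : edge n p q -> edge n p' q' -> p <= p' ->
  exists b c d, [/\ gen n (p, b, c, d), (b == 0) = (p' == 0) &
    (U_(inord p) + U_(inord q) + (U_(inord p') + U_(inord q')) = mon n (p, b, c, d))%MM].
Proof.
move=> /and3P[? ? pq0] /and3P[? ? pq0'] pp.
have H0 : p = 0 -> q <= n.+1 by move=> p0; move: pq0; rewrite p0.
have H0' : p' = 0 -> q' <= n.+1 by move=> p0; move: pq0'; rewrite p0.
have [?|?] := leqP q p'.
  exists q, p', q'; split; [by apply/genP; split; split; lia|lia|].
  by apply/mnmP => i; rewrite /mon !mnmDE; lia.
have [?|?] := leqP q q'.
  exists p', q, q'; split; [by apply/genP; split; split; lia|by []|].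
  by apply/mnmP => i; rewrite /mon !mnmDE; lia.
exists p', q', q; split; [by apply/genP; split; split; lia|by []|].
by apply/mnmP => i; rewrite /mon !mnmDE; lia.
Qed.

(** In a generator only the first two positions can be x, and they belong to different edges of the
    crosswise pairing; either edge may come from either ideal. *)
Definition mixed (B B' : pred bool) t : bool :=
  let: (a, b, _, _) := t in B (a == 0) && B' (b == 0) || B (b == 0) && B' (a == 0).

Lemma edge_mon_mul B B' m :
  (exists s s', [/\ edge_mon B s, edge_mon B' s' & m = (s + s')%MM]) <->
  exists t, [/\ gen n t, mixed B B' t & m = mon n t].
Proof.
split.
  move=> [_ [_ [[p [q [pq Bp ->]]] [p' [q' [pq' Bp' ->]]] ->]]].
  have [pp|/ltnW pp] := leqP p p'.
    have [b [c [d [g E ->]]]] := edge_mul pq pq' pp.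
    by exists (p, b, c, d); rewrite /mixed E Bp Bp'.
  have [b [c [d [g E]]]] := edge_mul pq' pq pp; rewrite addmC => ->.
  by exists (p', b, c, d); rewrite /mixed E Bp Bp' orbT.
move=> [[[[a b] c] d] [/and5P[ab bc cd ac bd] /orP[]/andP[Ba Bb] ->]].
  exists (U_(inord a) + U_(inord c))%MM, (U_(inord b) + U_(inord d))%MM.
  split; [by exists a, c|by exists b, d|].
  by apply/mnmP => i; rewrite /mon !mnmDE; lia.
exists (U_(inord b) + U_(inord d))%MM, (U_(inord a) + U_(inord c))%MM.
split; [by exists b, d|by exists a, c|].
by apply/mnmP => i; rewrite /mon !mnmDE; lia.
Qed.

Lemma ideal_mul_quads (I J : {mpoly k[n.+3]} -> Prop) B B' :
  ideal_eq I (mon_ideal (edge_mon B)) -> ideal_eq J (mon_ideal (edge_mon B')) ->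
  ideal_eq (ideal_mul I J)
    (mon_ideal (fun m => exists t, [/\ gen n t, mixed B B' t & m = mon n t])).
Proof.
move=> IB JB f; have [A1 A2] := ideal_mul_mon IB JB f.
have [E1 E2] := mon_ideal_ext (k:=k) (edge_mon_mul B B') f.
by split=> [/A1/E1|/E2/A2].
Qed.

Lemma min_gen_quads (I J : {mpoly k[n.+3]} -> Prop) B B' m :
  ideal_eq I (mon_ideal (edge_mon B)) -> ideal_eq J (mon_ideal (edge_mon B')) ->
  min_gen (ideal_mul I J) m <-> exists t, [/\ gen n t, mixed B B' t & m = mon n t].
Proof.
move=> IB JB; apply: (min_gen_homog (e:=4) (ideal_mul_quads IB JB)).
by move=> _ [t [_ _ ->]]; exact: mdeg_mon.
Qed.

Lemma min_gen_II m : min_gen (ideal_mul (idealI k n) (idealI k n)) m <->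
  exists t, gen n t /\ m = mon n t.
Proof.
rewrite (min_gen_quads _ idealI_mon idealI_mon).
split=> [[t [gt _ ->]]|[t [gt ->]]]; exists t; split=> //.
by case: t gt => [[[]]].
Qed.

Lemma min_gen_JJ m : min_gen (ideal_mul (idealJ k n) (idealJ k n)) m <->
  exists t, [/\ gen n t, kind n t = 0 & m = mon n t].
Proof.
rewrite (min_gen_quads _ idealJ_mon idealJ_mon).
split=> -[t [gt tk ->]]; exists t; split=> //; move: tk;
  by case: (kindP gt) => //= *; lia.
Qed.

Lemma min_gen_JK m : min_gen (ideal_mul (idealJ k n) (idealK k n)) m <->
  exists t, [/\ gen n t, 1 <= kind n t <= 4 & m = mon n t].
Proof.
rewrite (min_gen_quads _ idealJ_mon idealK_mon).
split=> -[t [gt tk ->]]; exists t; split=> //; move: tk;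
  by case: (kindP gt) => //= *; lia.
Qed.

Lemma min_gen_KK m : min_gen (ideal_mul (idealK k n) (idealK k n)) m <->
  exists t, [/\ gen n t, 5 <= kind n t & m = mon n t].
Proof.
rewrite (min_gen_quads _ idealK_mon idealK_mon).
split=> -[t [gt tk ->]]; exists t; split=> //; move: tk;
  by case: (kindP gt) => //= *; lia.
Qed.

(** Block (2d) is described by membership in J K; in the degree of the generators this is the same
    as being a minimal generator. *)
Lemma mem_JK m : mdeg m = 4 ->
  ideal_mul (idealJ k n) (idealK k n) 'X_[m] <->
  exists t, [/\ gen n t, 1 <= kind n t <= 4 & m = mon n t].
Proof.
move=> m4; rewrite -min_gen_JK; split=> [Im|[]//]; apply/min_gen_JK.
move: Im => /(ideal_mul_quads idealJ_mon idealK_mon)/mon_idealX[_ [t [gt tk ->]] tm].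
exists t; split=> //; last by rewrite (lem_mdeg_eq tm) // mdeg_mon.
by move: tk; case: (kindP gt) => //= *; lia.
Qed.

End Edges.

(** * The listings *)

Section Listings.
Variables (k : fieldType) (n : nat).
Implicit Types (t : quad) (ts : seq quad).

Definition is_block (e : nat) ts :=
  pairwise (before n) ts /\ forall t, (t \in ts) = gen n t && (kind n t == e).

Lemma lex_gt_trans (N : nat) (vs : seq 'I_N) : transitive (lex_gt vs).
Proof. by move=> m m' m''; rewrite /lex_gt => mm mm'; apply: lt_trans mm' mm. Qed.

Lemma map_preimage (T U : eqType) (f : T -> U) (Q : T -> Prop) (s : seq U) :
  (forall x, x \in s -> exists2 y, Q y & x = f y) ->
  exists2 ys, s = map f ys & forall y, y \in ys -> Q y.
Proof.
elim: s => [|x s IHs] Px; first by exists [::].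
have [|ys -> Qys] := IHs; first by move=> y ys; apply: Px; rewrite inE ys orbT.
have [|y Qy ->] := Px x; first by rewrite inE eqxx.
by exists (y :: ys) => // z; rewrite inE => /predU1P[->|/Qys].
Qed.

(** One implication between the two orders suffices for the equivalence, because [before] is total
    on generators and [lex_gt] is asymmetric. *)
Lemma lex_listing_block (vs : seq 'I_n.+3) (P : 'X_{1..n.+3} -> Prop) e s :
  (forall m, P m <-> exists t, [/\ gen n t, kind n t = e & m = mon n t]) ->
  (forall t t', gen n t -> gen n t' -> kind n t = e -> kind n t' = e ->
     before n t t' -> lex_gt vs (mon n t) (mon n t')) ->
  lex_listing vs P s <-> exists2 ts, is_block e ts & s = map (mon n) ts.
Proof.
move=> PE lex; split=> [[s_sorted sP]|[ts [ts_sorted tsE] ->]].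
  have [|ts Es Qts] := @map_preimage _ _ (mon n) (fun t => gen n t && (kind n t == e)) s.
    by move=> m /sP/PE[t [gt kt ->]]; exists t => //; rewrite gt kt eqxx.
  exists ts => //; split=> [|t].
    move: s_sorted; rewrite Es (sorted_pairwise (@lex_gt_trans _ vs)) pairwise_map.
    apply: (sub_in_pairwise (P := mem ts)); last by apply/allP.
    move=> t t' /Qts/andP[gt /eqP kt] /Qts/andP[gt' /eqP kt'].
    case: (before_total gt gt') => [->||/(lex _ _ gt' gt kt' kt)] //.
      by rewrite /= /lex_gt ltxx.
    by rewrite /= /lex_gt => /lt_gtF->.
  apply/idP/idP => [/Qts//|/andP[gt /eqP kt]].
  have : mon n t \in s by apply/sP/PE; exists t.
  rewrite Es => /mapP[t' t'ts /mon_inj ->] //.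
  by have /andP[] := Qts _ t'ts.
split.
  rewrite (sorted_pairwise (@lex_gt_trans _ vs)) pairwise_map.
  apply: (sub_in_pairwise (P := mem ts)) ts_sorted; last by apply/allP.
  move=> t t'; rewrite /= !tsE => /andP[gt /eqP kt] /andP[gt' /eqP kt'].
  exact: lex.
move=> m; rewrite PE; split=> [/mapP[t]|[t [gt kt ->]]].
  by rewrite tsE => /andP[gt /eqP kt ->]; exists t.
by apply: map_f; rewrite tsE gt kt eqxx.
Qed.

Lemma lex_gt_asc (l : seq nat) t t' p : gen n t -> gen n t' ->
  {subset l <= iota 0 n.+3} -> sorted ltn l -> p \in l ->
  {in l, forall q, q < p -> cnt t q = cnt t' q} -> cnt t' p < cnt t p ->
  lex_gt [seq inord q | q <- l] (mon n t) (mon n t').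
Proof.
move=> gt gt' lN l_sorted pl E lt.
have le q : q \in l -> q <= n.+2 by move/lN; rewrite mem_iota.
apply: (lex_gt_sorted ltn_trans l_sorted pl) => [q ql qp|]; last by rewrite !monE ?le.
by rewrite !monE ?le // E.
Qed.

Lemma lex_gt_desc (l : seq nat) t t' p : gen n t -> gen n t' ->
  {subset l <= iota 0 n.+3} -> sorted gtn l -> p \in l ->
  {in l, forall q, p < q -> cnt t q = cnt t' q} -> cnt t' p < cnt t p ->
  lex_gt [seq inord q | q <- l] (mon n t) (mon n t').
Proof.
move=> gt gt' lN l_sorted pl E lt.
have le q : q \in l -> q <= n.+2 by move/lN; rewrite mem_iota.
have T : transitive gtn by move=> y x z xy yz; apply: ltn_trans yz xy.
apply: (lex_gt_sorted T l_sorted pl) => [q ql qp|]; last by rewrite !monE ?le.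
by rewrite !monE ?le // E.
Qed.

Lemma vys_inord : vys n = [seq inord q | q <- iota 2 n].
Proof. by rewrite /vys (iotaDl 1 1) -map_comp. Qed.

Lemma kind_asc t : gen n t -> kind n t \in [:: 2; 4; 5] ->
  let: (a, b, c, d) := t in
  [/\ a = 0, b <> 1, 2 <= c <= n.+1 & 2 <= d] /\
  (b == 0) = (kind n t == 5) /\ (d == n.+2) = (kind n t == 2).
Proof.
by move=> gt; case: (kindP gt) => // *; split; first [by split; lia|by split; lia].
Qed.

Lemma kind_desc t : gen n t -> kind n t = 3 ->
  let: (a, b, c, d) := t in [/\ a = 0, b = 1, 2 <= c & d <= n.+1].
Proof. by move=> gt; case: (kindP gt). Qed.

Lemma kind_eq0 t : kind n t = 0 -> let: (a, b, c, d) := t in 0 < a.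
Proof.
by case: t => [[[a b] c] d]; rewrite /kind; case: ifP => // _; do !case: ifP.
Qed.

Lemma lex_gt_vys t t' : gen n t -> gen n t' -> kind n t = kind n t' ->
  kind n t' \in [:: 2; 4; 5] -> before n t t' -> lex_gt (vys n) (mon n t) (mon n t').
Proof.
move=> gt gt' E kt' B.
have kt : kind n t \in [:: 2; 4; 5] by rewrite E.
have cmp p : 2 <= p <= n.+1 -> (forall q, 2 <= q -> q < p -> cnt t q = cnt t' q) ->
    cnt t' p < cnt t p -> lex_gt (vys n) (mon n t) (mon n t').
  move=> pn Cp lt; rewrite vys_inord; apply: (lex_gt_asc (p := p)) => //.
  - by move=> q; rewrite !mem_iota; lia.
  - exact: iota_ltn_sorted.
  - by rewrite mem_iota; lia.
  - by move=> q; rewrite mem_iota => ? ?; apply: Cp; lia.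
have S := kind_asc gt kt; have S' := kind_asc gt' kt'; rewrite E in S.
case: t t' S S' gt gt' E kt kt' B cmp => [[[a b] c] d] [[[a' b'] c'] d'].
move=> [[-> ? ? ?] [<- <-]] [[-> ? ? ?] [Eb Ed]] gt gt' E kt kt' B.
have := before_inv gt' gt B; rewrite E ltnn => -[//|[_]].
have -> : kind n (0, b', c', d') \in [:: 0; 3] = false.
  by move: kt'; rewrite !inE => /or3P[]/eqP->.
clear B E kt kt'; move: gt gt' => /genP[[? ? ? ?] _] /genP[[? ? ? ?] _].
move=> B cmp; case: B; [lia|case=> _ ?|case=> _ ? ?; subst|case=> _ ? ? ?; subst].
(* Within one block b and b' vanish together, and b is not 1, so the first difference is at one of
   the y_i, which are the only variables compared. *)
- have ? : 2 <= b by lia.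
  apply: (cmp b); [lia|move=> q ? ?|]; cnt_lia.
- apply: (cmp c); [lia|move=> q ? ?|]; cnt_lia.
- apply: (cmp d); [lia|move=> q ? ?|]; cnt_lia.
Qed.

Lemma lex_gt_rev_vys t t' : gen n t -> gen n t' -> kind n t = 3 -> kind n t' = 3 ->
  before n t t' -> lex_gt (rev (vys n)) (mon n t) (mon n t').
Proof.
move=> gt gt' kt kt' B.
have cmp p : 2 <= p <= n.+1 -> (forall q, q <= n.+1 -> p < q -> cnt t q = cnt t' q) ->
    cnt t' p < cnt t p -> lex_gt (rev (vys n)) (mon n t) (mon n t').
  move=> pn Cp lt; rewrite vys_inord -map_rev; apply: (lex_gt_desc (p := p)) => //.
  - by move=> q; rewrite mem_rev !mem_iota; lia.
  - by rewrite rev_sorted iota_ltn_sorted.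
  - by rewrite mem_rev mem_iota; lia.
  - by move=> q; rewrite mem_rev mem_iota => ? ?; apply: Cp; lia.
have S := kind_desc gt kt; have S' := kind_desc gt' kt'.
case: t t' S S' gt gt' kt kt' B cmp => [[[a b] c] d] [[[a' b'] c'] d'].
move=> [-> -> ? ?] [-> -> ? ?] gt gt' kt kt' B.
have := before_inv gt' gt B; rewrite kt kt' ltnn => -[//|[_]] /=.
clear B kt kt'; move: gt gt' => /genP[[? ? ? ?] _] /genP[[? ? ? ?] _].
move=> B cmp; case: B; [move=> ?|case=> ? ?; subst|case=> *; lia|case=> *; lia].
- apply: (cmp d); [lia|move=> q ? ?|]; cnt_lia.
- apply: (cmp c); [lia|move=> q ? ?|]; cnt_lia.
Qed.

Lemma zvys_inord : vz2 n :: rcons (rev (vys n)) (vz1 n) = [seq inord q | q <- rev (iota 1 n.+2)].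
Proof.
have -> : iota 1 n.+2 = 1 :: rcons (iota 2 n) n.+2.
  by rewrite -cats1 -[[:: n.+2]]/(iota n.+2 1) -[n.+2]/(2 + n) -iotaD addn1.
rewrite rev_cons rev_rcons /= map_rcons inord_max vys_inord map_rev.
by [].
Qed.

Lemma lex_gt_zvys t t' : gen n t -> gen n t' -> kind n t = 0 -> kind n t' = 0 ->
  before n t t' -> lex_gt (vz2 n :: rcons (rev (vys n)) (vz1 n)) (mon n t) (mon n t').
Proof.
move=> gt gt' kt kt' B.
have cmp p : 1 <= p <= n.+2 -> (forall q, p < q -> cnt t q = cnt t' q) ->
    cnt t' p < cnt t p -> lex_gt (vz2 n :: rcons (rev (vys n)) (vz1 n)) (mon n t) (mon n t').
  move=> pn Cp lt; rewrite zvys_inord; apply: (lex_gt_desc (p := p)) => //.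
  - by move=> q; rewrite mem_rev !mem_iota; lia.
  - by rewrite rev_sorted iota_ltn_sorted.
  - by rewrite mem_rev mem_iota; lia.
  - by move=> q _; apply: Cp.
have S := kind_eq0 kt; have S' := kind_eq0 kt'.
case: t t' S S' gt gt' kt kt' B cmp => [[[a b] c] d] [[[a' b'] c'] d'] ? ? gt gt' kt kt' B.
have := before_inv gt' gt B; rewrite kt kt' ltnn => -[//|[_]] /=.
clear B kt kt'; move: gt gt' => /genP[[? ? ? ?] _] /genP[[? ? ? ?] _].
move=> B cmp; case: B; [move=> ?|case=> ? ?; subst|case=> ? ? ?; subst|case=> ? ? ? ?; subst].
- apply: (cmp d); [lia|move=> q ?|]; cnt_lia.
- apply: (cmp c); [lia|move=> q ?|]; cnt_lia.
- apply: (cmp b); [lia|move=> q ?|]; cnt_lia.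
- apply: (cmp a); [lia|move=> q ?|]; cnt_lia.
Qed.

Lemma listing1_block s : listing1 k s <-> exists2 ts, is_block 0 ts & s = map (mon n) ts.
Proof. by apply: lex_listing_block; [exact: min_gen_JJ|exact: lex_gt_zvys]. Qed.

Lemma asc_block P e s : e \in [:: 2; 4; 5] ->
  (forall m, P m <-> exists t, [/\ gen n t, kind n t = e & m = mon n t]) ->
  lex_listing (vys n) P s <-> exists2 ts, is_block e ts & s = map (mon n) ts.
Proof.
move=> e_asc PE; apply: lex_listing_block => // t t' gt gt' kt kt'.
by apply: lex_gt_vys; rewrite ?kt ?kt'.
Qed.

Lemma vxE : vx n = inord 0. Proof. by rewrite inord_0. Qed.
Lemma vz2E : vz2 n = inord n.+2. Proof. by rewrite inord_max. Qed.

Lemma listing2b_block s : listing2b s <-> exists2 ts, is_block 2 ts & s = map (mon n) ts.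
Proof.
have g b c : 2 <= b -> b <= c -> c <= n.+1 -> b <= n ->
    gen n (0, b, c, n.+2) /\ kind n (0, b, c, n.+2) = 2.
  move=> ? ? ? ?; split; first by apply/genP; split; split; lia.
  by rewrite /kind /= eqxx; do !case: ifP; lia.
apply: asc_block => // m; rewrite vxE vz2E; split.
  move=> [[i [j [i1 ij jn ->]]] neq]; have ? : i < n.
    rewrite ltn_neqAle (leq_trans ij jn) andbT; apply/eqP => E; apply: neq.
    have ? : j = n by lia.
    by subst.
  have [] : gen n (0, i.+1, j.+1, n.+2) /\ kind n (0, i.+1, j.+1, n.+2) = 2 by apply: g; lia.
  by exists (0, i.+1, j.+1, n.+2).
move=> [t [gt kt ->]]; move: kt; case: (kindP gt) => // b c ? ? ? ? _; split.
  by exists b.-1, c.-1; rewrite /vy !prednK; try lia; split=> //; lia.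
(* As 2 <= b <= n, the excluded monomial has exponent 0 at position b. *)
move=> /mnmP/(_ (inord b)); rewrite !mnmDE !mnm1E !inord_eq; lia.
Qed.

Lemma listing2c_block s : listing2c s <-> exists2 ts, is_block 3 ts & s = map (mon n) ts.
Proof.
have g c d : 2 <= c -> c <= d -> 3 <= d -> d <= n.+1 ->
    gen n (0, 1, c, d) /\ kind n (0, 1, c, d) = 3.
  move=> ? ? ? ?; split; first by apply/genP; split; split; lia.
  by rewrite /kind /=; do !case: ifP; lia.
apply: lex_listing_block; last exact: lex_gt_rev_vys.
move=> m; rewrite vxE; split.
  move=> [[i [j [i1 ij jn ->]]] neq]; have ? : 1 < j.
    rewrite ltn_neqAle (leq_trans i1 ij) andbT; apply/eqP => E; apply: neq.
    have ? : i = 1 by lia.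
    by subst.
  have [? ?] : gen n (0, 1, i.+1, j.+1) /\ kind n (0, 1, i.+1, j.+1) = 3 by apply: g; lia.
  exists (0, 1, i.+1, j.+1); split=> //.
  by apply/mnmP => l; rewrite /mon /vy /vz1 !mnmDE; lia.
move=> [t [gt kt ->]]; move: kt; case: (kindP gt) => // c d ? ? ? ? _; split.
  exists c.-1, d.-1; rewrite /vy !prednK; try lia; split; try lia.
  by apply/mnmP => l; rewrite /mon /vy /vz1 !mnmDE; lia.
move=> /mnmP/(_ (inord d)); rewrite !mnmDE !mnm1E !inord_eq; lia.
Qed.

Lemma listing2d_block s : listing2d k s <-> exists2 ts, is_block 4 ts & s = map (mon n) ts.
Proof.
apply: asc_block => // m; rewrite vxE; split.
  move=> [[i [j [l [i1 ij jl ln ->]]]]].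
  rewrite mem_JK; last by rewrite !mdegD !mdeg1.
  move=> [t [gt tk E]]; rewrite E; exists t; split=> //.
  (* Neither z1 nor z2 divides the monomial, which rules out blocks 1 to 3. *)
  have m0 p : p = 1 \/ p = n.+2 -> cnt t p = 0.
    move=> pn; rewrite -(monE gt); last by case: pn => ->.
    by rewrite -E !mnmDE !mnm1E !inord_eq; lia.
  have := m0 1 (or_introl erefl); have := m0 n.+2 (or_intror erefl).
  by move: tk; case: (kindP gt); rewrite // /cnt ?eqxx /=; lia.
move=> [t [gt kt ->]]; split; last first.
  by apply/mem_JK; [exact: mdeg_mon|exists t; rewrite kt].
move: kt; case: (kindP gt) => // b c d ? ? ? ? ? _.
exists b.-1, c.-1, d.-1; rewrite /vy !prednK; try lia; split=> //; lia.
Qed.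

Lemma listing3a_block s : listing3a s <-> exists2 ts, is_block 5 ts & s = map (mon n) ts.
Proof.
have g c d : 2 <= c -> c <= d -> 3 <= d -> d <= n.+1 ->
    gen n (0, 0, c, d) /\ kind n (0, 0, c, d) = 5.
  move=> ? ? ? ?; split; first by apply/genP; split; split; lia.
  by rewrite /kind /=; do !case: ifP; lia.
apply: asc_block => // m; rewrite vxE; split.
  move=> [[i [j [i1 ij jn ->]]] neq]; have ? : 1 < j.
    rewrite ltn_neqAle (leq_trans i1 ij) andbT; apply/eqP => E; apply: neq.
    have ? : i = 1 by lia.
    by subst.
  have [] : gen n (0, 0, i.+1, j.+1) /\ kind n (0, 0, i.+1, j.+1) = 5 by apply: g; lia.
  by exists (0, 0, i.+1, j.+1).
move=> [t [gt kt ->]]; move: kt; case: (kindP gt) => // c d ? ? ? ? _; split.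
  by exists c.-1, d.-1; rewrite /vy !prednK; try lia; split=> //; lia.
move=> /mnmP/(_ (inord d)); rewrite !mnmDE !mnm1E !inord_eq; lia.
Qed.

Lemma list2a_block : exists2 ts, is_block 1 ts & list2a n = map (mon n) ts.
Proof.
exists [seq (0, 1, i.+1, n.+2) | i <- iota 1 n]; last first.
  rewrite /list2a -map_comp; apply: eq_map => i; rewrite /= vxE vz2E.
  by apply/mnmP => l; rewrite /vy /vz1 !mnmDE; lia.
split.
  rewrite pairwise_map; apply: (@sub_pairwise _ ltn).
    move=> i j ij; rewrite /= beforeE /kind /= !eqxx /=; lia.
  by rewrite -(sorted_pairwise ltn_trans) iota_ltn_sorted.
move=> t; apply/mapP/andP => [[i]|[gt /eqP]].
  rewrite mem_iota => ? ->; split; last by rewrite /kind /= eqxx.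
  by apply/genP; split; split; lia.
by case: (kindP gt) => // c ? _; exists c.-1; [rewrite mem_iota; lia|rewrite prednK //; lia].
Qed.

Lemma list3b_block : 0 < n -> exists2 ts, is_block 6 ts & list3b n = map (mon n) ts.
Proof.
move=> n0; exists [:: (0, 0, 2, 2)]; last by rewrite /list3b vxE.
split=> // t; rewrite inE; apply/eqP/andP => [->|[gt /eqP]].
  by split; first by apply/genP; split; split; lia.
by case: (kindP gt).
Qed.

(** * Assembling the blocks, and linear quotients *)

Lemma block_sorted e ts : is_block e ts -> pairwise (before n) ts.
Proof. by case. Qed.

Lemma block_allrel e ts e' ts' : is_block e ts -> is_block e' ts' -> e < e' ->
  allrel (before n) ts ts'.
Proof.
move=> [_ E] [_ E'] ee; apply/allrelP => t t'; rewrite E E' => /andP[_ /eqP kt] /andP[_ /eqP kt'].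
by rewrite beforeE kt kt' ee.
Qed.

Lemma kind_lt7 t : kind n t < 7.
Proof. by case: t => [[[a b] c] d]; rewrite /kind; do !case: ifP. Qed.

Lemma square_listing_quads s : 0 < n -> square_listing k s ->
  exists2 ts, pairwise (before n) ts /\ ts =i gen n & s = map (mon n) ts.
Proof.
move=> n0 [s1 [s2 [s3 [/listing1_block[t0 B0 ->]
  [_ [s2b [s2c [s2d [H1 H2 H3 ->]]]]] [_ [s3a H4 ->]] ->]]]].
move: H1 H2 H3 H4 => /listing2b_block[t2 B2 ->] /listing2c_block[t3 B3 ->].
move=> /listing2d_block[t4 B4 ->] /listing3a_block[t5 B5 ->].
have [t1 B1 ->] := list2a_block; have [t6 B6 ->] := list3b_block n0.
exists (t0 ++ (t1 ++ t2 ++ t3 ++ t4) ++ (t5 ++ t6)); last by rewrite !map_cat.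
split.
  rewrite !pairwise_cat !allrel_catr !allrel_catl.
  by repeat (apply/andP; split); first [eapply block_allrel; eauto | eapply block_sorted; eauto].
move=> t; rewrite !mem_cat B0.2 B1.2 B2.2 B3.2 B4.2 B5.2 B6.2 -topredE /=.
by case: (gen n t) => //=; move: (kind_lt7 t); case: (kind n t) => [|[|[|[|[|[|[|]]]]]]].
Qed.

(** Besides sorting the blocks, one has to see that (2) and (3) exhaust the minimal generators of J
    K and K^2; these are the kinds 1 to 4 and 5 to 6. *)
Lemma square_listing_exists : 0 < n -> exists s : seq 'X_{1..n.+3}, square_listing k s.
Proof.
move=> n0; have [t0 B0] := blocks_exist n 0; have [t2 B2] := blocks_exist n 2.
have [t3 B3] := blocks_exist n 3; have [t4 B4] := blocks_exist n 4.
have [t5 B5] := blocks_exist n 5.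
have [t1 B1 E1] := list2a_block; have [t6 B6 E6] := list3b_block n0.
exists (map (mon n) t0 ++ (map (mon n) t1 ++ map (mon n) t2 ++ map (mon n) t3 ++ map (mon n) t4)
   ++ (map (mon n) t5 ++ map (mon n) t6)).
do 3 eexists; split; last by [].
- by apply/listing1_block; exists t0.
- split; last first.
    exists (map (mon n) t2), (map (mon n) t3), (map (mon n) t4); rewrite E1; split=> //.
    + by apply/listing2b_block; exists t2.
    + by apply/listing2c_block; exists t3.
    + by apply/listing2d_block; exists t4.
  move=> m; rewrite min_gen_JK -!map_cat; split.
    move=> /mapP[t]; rewrite !mem_cat B1.2 B2.2 B3.2 B4.2.
    by move=> /or4P[]/andP[gt /eqP kt] ->; exists t; rewrite kt.
  move=> [t [gt kt ->]]; apply: map_f; rewrite !mem_cat B1.2 B2.2 B3.2 B4.2 gt /=.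
  by move: kt; case: (kind n t) => [|[|[|[|[|]]]]].
- split; last first.
    exists (map (mon n) t5); last by rewrite E6.
    by apply/listing3a_block; exists t5.
  move=> m; rewrite min_gen_KK -map_cat; split.
    move=> /mapP[t]; rewrite !mem_cat B5.2 B6.2.
    by move=> /orP[]/andP[gt /eqP kt] ->; exists t; rewrite kt.
  move=> [t [gt kt ->]]; apply: map_f; rewrite !mem_cat B5.2 B6.2 gt /=.
  by move: kt (kind_lt7 t); case: (kind n t) => [|[|[|[|[|[|[|]]]]]]].
Qed.

Lemma quads_linear ts : 2 <= n -> pairwise (before n) ts -> ts =i gen n ->
  linear_quotients_ordering (ideal_mul (idealI k n) (idealI k n)) (map (mon n) ts).
Proof.
move=> n2 ts_sorted tsE.
have ts_uniq : uniq ts.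
  by apply: pairwise_uniq ts_sorted => t; rewrite /before ltxx.
split.
- by eexists; apply: ideal_mul_quads; exact: idealI_mon.
- by rewrite map_inj_in_uniq // => t t'; rewrite !tsE; apply: mon_inj.
- move=> m; rewrite min_gen_II; split=> [/mapP[t]|[t [gt ->]]].
    by rewrite tsE => gt ->; exists t.
  by apply: map_f; rewrite tsE.
move=> i /andP[_]; rewrite size_map => is_; pose t0 : quad := (0, 0, 0, 0).
rewrite (nth_map t0) // -map_take.
have [gt E] : gen n (nth t0 ts i) /\ ts = take i ts ++ nth t0 ts i :: drop i.+1 ts.
  by have := mem_nth t0 is_; rewrite tsE -drop_nth // cat_take_drop.
set t := nth t0 ts i in gt E *; set r := take i ts in E *.
(* Since [ts] is sorted and complete, its segment up to t consists of all generators before t, so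
   the t'' supplied by [exchange] is found there. *)
have rE t' : (t' \in r) = gen n t' && before n t' t.
  move: ts_sorted (tsE t'); rewrite E pairwise_cat pairwise_cons allrel_consr.
  move=> /and3P[/andP[/allP rt _] _ /andP[/allP td _]].
  rewrite mem_cat inE -[RHS]topredE /= => <-.
  case: (boolP (t' \in r)) => [/rt->//|_] /=.
  by apply/esym/negP => /andP[/predU1P[->|/td/before_asym/negP]]; rewrite /before ?ltxx.
apply: linear_colon => _ /mapP[t' + ->]; rewrite rE => /andP[gt' B].
have [t'' [v [gt'' B'' vn lt le]]] := exchange n2 gt gt' B.
exists (inord v), (mon n t''); split.
- by rewrite !monE.
- by apply: map_f; rewrite rE gt'' B''.
apply/mnm_lepP => j; have jn : j <= n.+2 by rewrite -ltnS.
by rewrite mnmDE mnm1E -[j]inord_val inord_eq // !monE.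
Qed.
End Listings.

Theorem theorem4p2 (k : fieldType) (n : nat) (hn : 2 <= n) :
  let I2 := ideal_mul (idealI k n) (idealI k n) in
  [/\ has_linear_quotients I2,
      (exists s : seq 'X_{1..n.+3}, square_listing k s) &
      forall s : seq 'X_{1..n.+3}, square_listing k s -> linear_quotients_ordering I2 s].
Proof.
have lin s : square_listing k s ->
    linear_quotients_ordering (ideal_mul (idealI k n) (idealI k n)) s.
  by move=> /(square_listing_quads (ltnW hn))[ts [sorted_ts tsE] ->]; apply: quads_linear.
have [s sL] := square_listing_exists k (ltnW hn).
by split=> //; exists s => //; apply: lin.
Qed.
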